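(* Let the problem (P) be Fréchet differentiable. Then each second-order Kuhn-Tucker stationary point of (P) is a global Pareto minimizer of (P) if and only if (P) is second-order KT-pseudoinvex-II.
   Context: All vector inequalities are componentwise. Problem (P): minimize $f(x)$ subject to $x\in X$, $g(x)\le 0$, where $X\subset\mathbb{R}^s$ is open, $f=(f_1,\dots,f_n):X\to\mathbb{R}^n$, $g=(g_1,\dots,g_m):X\to\mathbb{R}^m$. $S=\{x\in X: g(x)\le 0\}$; for $x\in S$, $A(x)=\{j: g_j(x)=0\}$. (P) is Fréchet differentiable if $f$ and $g$ are Fréchet differentiable on $X$. A direction $d\in\mathbb{R}^s$ is critical at $x\in S$ if $\nabla f_i(x)d\le 0$ for all $i$ and $\nabla g_j(x)d\le 0$ for all $j\in A(x)$; $D(x)$ denotes the set of critical directions at $x$. For $h:X\to\mathbb{R}$ differentiable at $x$, the second-order directional derivative in direction $d\in\mathbb{R}^s$ is $h''(x,d)=\lim_{t\to+0}2t^{-2}[h(x+td)-h(x)-t\nabla h(x)d]$. A point $x\in S$ is a global Pareto minimizer if there is no $y\in S$ with $f_i(y)\le f_i(x)$ for all $i=1,\dots,n$ and $f(y)\neq f(x)$. A point $x\in S$ is a second-order Kuhn-Tucker stationary point if for every critical direction $d\in\mathbb{R}^s$ at $x$ such that the derivatives $f_i''(x,d)$ ($i=1,\dots,n$) and $g_j''(x,d)$ ($j\in A(x)$) exist with finite values, there are $\lambda\in\mathbb{R}^n$, $\lambda\ge0$, $\lambda\ne0$, and $\mu\in\mathbb{R}^m$, $\mu\ge0$ (possibly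 depending on $d$), with $\mu_jg_j(x)=0$ for all $j$, $\sum_{i=1}^n\lambda_i\nabla f_i(x)+\sum_{j\in A(x)}\mu_j\nabla g_j(x)=0$, and $\sum_{i=1}^n\lambda_if_i''(x,d)+\sum_{j\in A(x)}\mu_jg_j''(x,d)\ge0$. A Fréchet differentiable problem (P) is second-order KT-pseudoinvex-II if there exist maps $d:X\times X\to\mathbb{R}^s$, $\eta:X\times X\to\mathbb{R}^s$ and a function $\omega:X\times X\to[0,+\infty)$ such that for all $x,y\in X$ with $g(x)\le0$, $g(y)\le0$, $f_i(y)\le f_i(x)$ for all $i=1,\dots,n$ and $f(y)\ne f(x)$: $d(x,y)\in D(x)$; the derivatives $f_i''(x,d(x,y))$ ($i=1,\dots,n$) and $g_j''(x,d(x,y))$ ($j\in A(x)$) exist with finite values; $\nabla f_i(x)\eta(x,y)+\omega(x,y)f_i''(x,d(x,y))<0$ for all $i=1,\dots,n$; and $\nabla g_j(x)\eta(x,y)+\omega(x,y)g_j''(x,d(x,y))\le0$ for all $j\in A(x)$. *)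

(* Defs.v *)
From mathcomp Require Import all_boot all_order all_algebra.
From mathcomp Require Import all_classical all_reals all_analysis.

Set Implicit Arguments.
Unset Strict Implicit.
Unset Printing Implicit Defensive.

Import Order.TTheory GRing.Theory Num.Theory.
Import numFieldNormedType.Exports.

Local Open Scope classical_set_scope.
Local Open Scope ring_scope.

(* Points and directions of R^s are row vectors.  Maps defined on the open set
   X are represented by total functions; only their values on X matter below,
   since differentials and one-sided limits at a point of X are local. *)

Definition coordf (R : realType) (s n : nat) (f : 'rV[R]_s -> 'rV[R]_n)
    (i : 'I_n) : 'rV[R]_s -> R :=
  fun x => f x ord0 i.

(* The product of the gradient of h at x with a direction d is written
   ['d h x d]; [grad h x] is the coordinate vector of the linear form
   ['d h x]. *)
Definition grad (R : realType) (s : nat) (h : 'rV[R]_s -> R) (x : 'rV[R]_s) :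
    'rV[R]_s :=
  \row_(k < s) 'd h x (delta_mx ord0 k).

Definition diff_quotient2 (R : realType) (s : nat) (h : 'rV[R]_s -> R)
    (x d : 'rV[R]_s) (t : R) : R :=
  2 * t ^- 2 * (h (x + t *: d) - h x - t * 'd h x d).

(* Convergence is in R, so an infinite limit does not qualify. *)
Definition derivable2 (R : realType) (s : nat) (h : 'rV[R]_s -> R)
    (x d : 'rV[R]_s) : Prop :=
  cvg (diff_quotient2 h x d t @[t --> 0^'+]).

Definition derive2 (R : realType) (s : nat) (h : 'rV[R]_s -> R)
    (x d : 'rV[R]_s) : R :=
  lim (diff_quotient2 h x d t @[t --> 0^'+]).

Definition frechet_differentiable_problem (R : realType) (s n m : nat)
    (X : set 'rV[R]_s) (f : 'rV[R]_s -> 'rV[R]_n) (g : 'rV[R]_s -> 'rV[R]_m) :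
    Prop :=
  forall x, X x -> differentiable f x /\ differentiable g x.

Definition feasible (R : realType) (s m : nat)
    (X : set 'rV[R]_s) (g : 'rV[R]_s -> 'rV[R]_m) : set 'rV[R]_s :=
  [set x | X x /\ forall j, coordf g j x <= 0].

Definition active (R : realType) (s m : nat) (g : 'rV[R]_s -> 'rV[R]_m)
    (x : 'rV[R]_s) : {set 'I_m} :=
  [set j | coordf g j x == 0]%SET.

Definition critical (R : realType) (s n m : nat)
    (f : 'rV[R]_s -> 'rV[R]_n) (g : 'rV[R]_s -> 'rV[R]_m) (x : 'rV[R]_s) :
    set 'rV[R]_s :=
  [set d | (forall i, 'd (coordf f i) x d <= 0) /\
           (forall j, j \in active g x -> 'd (coordf g j) x d <= 0)].

Definition derivable2_problem (R : realType) (s n m : nat)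
    (f : 'rV[R]_s -> 'rV[R]_n) (g : 'rV[R]_s -> 'rV[R]_m) (x d : 'rV[R]_s) :
    Prop :=
  (forall i, derivable2 (coordf f i) x d) /\
  (forall j, j \in active g x -> derivable2 (coordf g j) x d).

Definition pareto_dominates (R : realType) (s n : nat)
    (f : 'rV[R]_s -> 'rV[R]_n) (y x : 'rV[R]_s) : Prop :=
  (forall i, coordf f i y <= coordf f i x) /\ f y <> f x.

Definition global_pareto_minimizer (R : realType) (s n m : nat)
    (X : set 'rV[R]_s) (f : 'rV[R]_s -> 'rV[R]_n) (g : 'rV[R]_s -> 'rV[R]_m)
    (x : 'rV[R]_s) : Prop :=
  feasible X g x /\ ~ exists y, feasible X g y /\ pareto_dominates f y x.

Definition KT_stationary2 (R : realType) (s n m : nat)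
    (X : set 'rV[R]_s) (f : 'rV[R]_s -> 'rV[R]_n) (g : 'rV[R]_s -> 'rV[R]_m)
    (x : 'rV[R]_s) : Prop :=
  feasible X g x /\
  forall d, critical f g x d -> derivable2_problem f g x d ->
  exists (lambda : 'rV[R]_n) (mu : 'rV[R]_m),
    [/\ (forall i, 0 <= lambda ord0 i) /\ lambda <> 0,
        forall j, 0 <= mu ord0 j,
        forall j, mu ord0 j * coordf g j x = 0,
        \sum_(i < n) lambda ord0 i *: grad (coordf f i) x +
        \sum_(j in active g x) mu ord0 j *: grad (coordf g j) x = 0 &
        0 <= \sum_(i < n) lambda ord0 i * derive2 (coordf f i) x d +
             \sum_(j in active g x) mu ord0 j * derive2 (coordf g j) x d].

Definition KT_pseudoinvexII2 (R : realType) (s n m : nat)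
    (X : set 'rV[R]_s) (f : 'rV[R]_s -> 'rV[R]_n) (g : 'rV[R]_s -> 'rV[R]_m) :
    Prop :=
  exists (d eta : 'rV[R]_s -> 'rV[R]_s -> 'rV[R]_s)
         (omega : 'rV[R]_s -> 'rV[R]_s -> R),
    (forall x y, X x -> X y -> 0 <= omega x y) /\
    forall x y, feasible X g x -> feasible X g y -> pareto_dominates f y x ->
      [/\ critical f g x (d x y),
          derivable2_problem f g x (d x y),
          forall i, 'd (coordf f i) x (eta x y) +
                    omega x y * derive2 (coordf f i) x (d x y) < 0 &
          forall j, j \in active g x ->
                    'd (coordf g j) x (eta x y) +
                    omega x y * derive2 (coordf g j) x (d x y) <= 0].

(* Main.v *)
Require Import Defs.
From mathcomp Require Import all_boot all_order all_algebra.
From mathcomp Require Import all_classical all_reals all_analysis.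
From mathcomp Require Import ring lra.
Import numFieldNormedType.Exports.
Import Order.TTheory GRing.Theory Num.Theory.

Local Open Scope ring_scope.

(** At a fixed critical direction [d], multipliers for the second-order
    Kuhn-Tucker conditions are exactly the dual certificate of the system in
    the unknowns [(eta, omega)] that defines pseudoinvexity: with the rows
    [(grad f_i, f_i'')], [(grad g_j, g_j'')] for the active [j], and [(0, -1)],
    which encodes [0 <= omega], Motzkin's transposition theorem says that
    either the system with strict inequalities for the [f_i] is solvable or
    some nonnegative combination of the rows, not all weights on the [f_i]
    being zero, vanishes.  The weight on [(0, -1)] is the slack in the
    second-order inequality.

    If stationarity implies minimality, a dominated feasible point is not
    stationary, so some critical direction along which the second-order
    derivatives exist has no multipliers; the alternative then provides [eta] and
    [omega] ([alternative_multipliers]), and choice turns them into maps.  Conversely, a system solvable at a point with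
    multipliers is contradictory: pair the multipliers with the inequalities
    ([multipliers_exclude_solution]).

    Motzkin's theorem follows from Farkas' lemma by an extra coordinate that
    measures the strictness. *)

(** * Farkas' lemma and Motzkin's transposition theorem *)

Definition dot {R : comPzRingType} {k : nat} (u v : 'rV[R]_k) : R :=
  (u *m v^T) ord0 ord0.

Section Dot.
Variables (R : comPzRingType) (k : nat).
Implicit Types u v w : 'rV[R]_k.

Lemma dotC u v : dot u v = dot v u.
Proof. by rewrite /dot -[in LHS](trmxK u) -trmx_mul mxE. Qed.

Lemma dotE u v : dot u v = \sum_i u ord0 i * v ord0 i.
Proof. by rewrite /dot mxE; apply: eq_bigr => i _; rewrite mxE. Qed.

Lemma dotBl u v w : dot (u - v) w = dot u w - dot v w.
Proof. by rewrite /dot mulmxBl mxE [X in _ + X]mxE. Qed.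

Lemma dotZl c u v : dot (c *: u) v = c * dot u v.
Proof. by rewrite /dot -scalemxAl mxE. Qed.

Lemma dotDl u v w : dot (u + v) w = dot u w + dot v w.
Proof. by rewrite /dot mulmxDl mxE. Qed.

Lemma dot0l v : dot 0 v = 0.
Proof. by rewrite /dot mul0mx mxE. Qed.

Lemma dotBr u v w : dot u (v - w) = dot u v - dot u w.
Proof. by rewrite dotC dotBl !(dotC u). Qed.

Lemma dotZr c u v : dot u (c *: v) = c * dot u v.
Proof. by rewrite dotC dotZl dotC. Qed.

Lemma dotNr u v : dot u (- v) = - dot u v.
Proof. by rewrite -scaleN1r dotZr mulN1r. Qed.

Lemma dot_suml (I : Type) (r : seq I) (P : pred I) (F : I -> 'rV[R]_k) v :
  dot (\sum_(i <- r | P i) F i) v = \sum_(i <- r | P i) dot (F i) v.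
Proof. by rewrite /dot mulmx_suml summxE. Qed.

Lemma dot_row_mx u (a : R) (v : 'rV[R]_(k + 1)) :
  dot (row_mx u a%:M) v = dot u (lsubmx v) + a * rsubmx v ord0 ord0.
Proof.
rewrite /dot -{1}(hsubmxK v) tr_row_mx mul_row_col mxE; congr (_ + _).
by rewrite mul_scalar_mx !mxE.
Qed.

Lemma sum_row_mx (I : finType) (P : pred I) (c : I -> R)
    (u : I -> 'rV[R]_k) (x : I -> R) :
  \sum_(i | P i) c i *: (row_mx (u i) (x i)%:M : 'rV[R]_(k + 1)) =
  row_mx (\sum_(i | P i) c i *: u i) (\sum_(i | P i) c i * x i)%:M.
Proof.
elim/big_rec3: _ => [|i y x' z _ ->]; first by rewrite raddf0 row_mx0.
by rewrite scale_row_mx scale_scalar_mx add_row_mx raddfD.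
Qed.

Lemma eq_row_mx_scalar (u v : 'rV[R]_k) (a b : R) :
  row_mx u a%:M = row_mx v b%:M :> 'rV[R]_(k + 1) -> u = v /\ a = b.
Proof.
by case/eq_row_mx=> -> /(congr1 (fun w : 'M[R]_1 => w ord0 ord0)); rewrite !mxE !mulr1n.
Qed.

End Dot.

Lemma dot_gt0 {R : realDomainType} {k : nat} (u : 'rV[R]_k) :
  u != 0 -> 0 < dot u u.
Proof.
move=> /rV0Pn[i ui]; rewrite dotE (bigD1 i) //=.
rewrite ltr_pwDl ?sumr_ge0 // => [|j _]; last by rewrite -expr2 sqr_ge0.
by rewrite -expr2 exprn_even_gt0.
Qed.

(** Induction on the number of generators.  When the functional [z] separating
    [b] from the cone of the tail is negative on the new generator [a i0],
    project everything along [a i0] onto the hyperplane orthogonal to [z]: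
    either the projection of [b] lies in the projected cone, and lifting it
    back costs a nonnegative multiple of [a i0] because [z] is negative on [b]
    and nonnegative on the tail, or it is separated from it by some [z'], and
    [z'] corrected along [z] so as to vanish on [a i0] separates [b]. *)
Lemma farkas {R : realFieldType} {k : nat} {I : eqType} (r : seq I)
    (a : I -> 'rV[R]_k) (b : 'rV[R]_k) : uniq r ->
  (exists c : I -> R, (forall i, 0 <= c i) /\
     b = \sum_(i <- r) c i *: a i) \/
  (exists z, (forall i, i \in r -> 0 <= dot (a i) z) /\ dot b z < 0).
Proof.
elim: r a b => [|i0 r IHr] a b /=.
  move=> _; have [->|b0] := eqVneq b 0.
    by left; exists (fun=> 0); split=> //; rewrite big_nil.
  by right; exists (- b); split=> //; rewrite dotNr oppr_lt0 dot_gt0.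
case/andP=> i0r ur.
have ext (c : I -> R) (e : R) : \sum_(i <- i0 :: r)
    (if i == i0 then e else c i) *: a i = e *: a i0 + \sum_(i <- r) c i *: a i.
  rewrite big_cons eqxx; congr (_ + _); apply: eq_big_seq => i ir.
  by case: eqP ir i0r => // -> ->.
case: (IHr a b ur) => [[c [c0 ->]]|[z [az bz]]].
  left; exists (fun i => if i == i0 then 0 else c i); split=> [i|].
    by case: eqP.
  by rewrite ext scale0r add0r.
have [az0|az0] := lerP 0 (dot (a i0) z).
  right; exists z; split=> // i; rewrite inE => /predU1P[->//|]; exact: az.
pose p := dot (a i0) z.
have p_neq0 : p != 0 by rewrite lt_eqF.
pose proj v := v - (dot v z / p) *: a i0.
case: (IHr (proj \o a) (proj b) ur) => [[c [c0 cb]]|[z' [az' bz']]].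
  left; pose e := dot b z / p - \sum_(i <- r) c i * (dot (a i) z / p).
  exists (fun i => if i == i0 then e else c i); split=> [i|].
    case: eqP => // _; rewrite /e -sumrN addr_ge0 //.
      by rewrite ltW // nmulr_rgt0 // invr_lt0.
    rewrite big_seq sumr_ge0 // => j jr.
    rewrite -mulrN mulr_ge0 // -mulrN mulr_ge0 ?az //.
    by rewrite oppr_ge0 invr_le0 ltW.
  rewrite ext /e scalerBl scaler_suml addrAC -addrA -sumrB.
  move: cb; rewrite /proj => /eqP; rewrite subr_eq addrC => /eqP {1}->.
  congr (_ + _); apply: eq_bigr => i _ /=.
  by rewrite scalerBr scalerA.
right; pose z2 := z' - (dot (a i0) z' / p) *: z.
have dot2 v : dot v z2 = dot (proj v) z'.
  by rewrite /z2 /proj dotBr dotBl dotZr dotZl; field.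
exists z2; split=> [i|]; last by rewrite dot2.
rewrite inE => /predU1P[->|ir]; last by rewrite dot2 az'.
by rewrite dot2 /proj -/p divff // scale1r subrr dot0l.
Qed.

(** Apply Farkas' lemma with one more coordinate, in which the strict rows
    have entry 1 and the others entry 0, to the last basis vector: a
    combination of the rows equal to it has strict weights of sum 1, and a
    separating vector has a negative last entry, which makes the inequalities
    for the strict rows strict. *)
Lemma motzkin_transposition {R : realFieldType} {k : nat} {I J : finType}
    (a : I -> 'rV[R]_k) (b : J -> 'rV[R]_k) :
  (exists z, (forall i, dot (a i) z < 0) /\ (forall j, dot (b j) z <= 0)) \/
  (exists (l : I -> R) (u : J -> R),
     [/\ forall i, 0 <= l i, forall j, 0 <= u j, \sum_i l i = 1 &
         \sum_i l i *: a i + \sum_j u j *: b j = 0]).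
Proof.
pose v (x : I + J) : 'rV[R]_(k + 1) :=
  match x with inl i => row_mx (a i) 1%:M | inr j => row_mx (b j) 0%:M end.
have [[c [c0]]|[z [vz bz]]] :=
    farkas (index_enum (I + J)%type) v (row_mx 0 1%:M) (index_enum_uniq _).
  rewrite big_sumType /= !sum_row_mx add_row_mx -raddfD /=.
  rewrite (eq_bigr (c \o inl)) => [|i _]; last by rewrite mulr1.
  rewrite [X in (_ + X)%:M]big1 => [|j _]; last by rewrite mulr0.
  rewrite addr0 => /eq_row_mx_scalar[/esym comb /esym c1].
  by right; exists (c \o inl), (c \o inr); split=> [i|j||] //=; exact: c0.
left; exists (- lsubmx z); move: bz; rewrite dot_row_mx dot0l add0r mul1r => bz.
split=> [i|j]; rewrite dotNr.
  have := vz (inl i) (mem_index_enum _); rewrite dot_row_mx mul1r; lra.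
have := vz (inr j) (mem_index_enum _); rewrite dot_row_mx mul0r; lra.
Qed.

(** * Multipliers of the second-order system *)

Lemma diff_gradE {R : realType} {s : nat} (h : 'rV[R]_s -> R)
    (x d : 'rV[R]_s) : 'd h x d = dot (grad h x) d.
Proof.
rewrite dotE {1}(row_sum_delta d) linear_sum; apply: eq_bigr => i _.
by rewrite linearZ /= mxE mulrC.
Qed.

Section SecondOrderSystem.
Variables (R : realFieldType) (s n m : nat).
Variables (F : 'I_n -> 'rV[R]_s) (F2 : 'I_n -> R).
Variables (G : 'I_m -> 'rV[R]_s) (G2 : 'I_m -> R) (A : {set 'I_m}).

(** The system is encoded in dimension [s + 1], the last entry being [omega];
    the index [inr tt] carries the row [(0, -1)] for [0 <= omega], and inactive
    indices carry the zero row so that their weights can be discarded. *)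
Lemma alternative_multipliers :
  (exists (eta : 'rV[R]_s) (omega : R),
     [/\ 0 <= omega, forall i, dot (F i) eta + omega * F2 i < 0 &
         forall j, j \in A -> dot (G j) eta + omega * G2 j <= 0]) \/
  (exists (lambda : 'rV[R]_n) (mu : 'rV[R]_m),
     [/\ (forall i, 0 <= lambda ord0 i) /\ lambda <> 0,
         forall j, 0 <= mu ord0 j,
         forall j, j \notin A -> mu ord0 j = 0,
         \sum_(i < n) lambda ord0 i *: F i +
         \sum_(j in A) mu ord0 j *: G j = 0 &
         0 <= \sum_(i < n) lambda ord0 i * F2 i +
              \sum_(j in A) mu ord0 j * G2 j]).
Proof.
pose a i : 'rV[R]_(s + 1) := row_mx (F i) (F2 i)%:M.
pose b (o : 'I_m + unit) : 'rV[R]_(s + 1) :=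
  if o is inl j then (if j \in A then row_mx (G j) (G2 j)%:M else 0)
  else row_mx 0 (-1)%:M.
have [[z [az bz]]|[l [u [l0 u0 l1]]]] := motzkin_transposition a b.
  left; exists (lsubmx z), (rsubmx z ord0 ord0); split=> [|i|j jA].
  - have := bz (inr tt).
    by rewrite dot_row_mx dot0l add0r mulN1r oppr_le0.
  - by have := az i; rewrite dot_row_mx (mulrC (F2 i)).
  - by have := bz (inl j); rewrite /b jA dot_row_mx (mulrC (G2 j)).
pose mu : 'rV[R]_m := \row_j (if j \in A then u (inl j) else 0).
have -> : \sum_o u o *: b o =
    \sum_(j in A) mu ord0 j *: row_mx (G j) (G2 j)%:M + u (inr tt) *: b (inr tt).
  rewrite big_sumType /= [X in _ + X](big_pred1 tt) => [|[]//].
  congr (_ + _); rewrite [RHS]big_mkcond; apply: eq_bigr => j _.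
  by rewrite mxE; case: ifP => // _; rewrite scaler0.
rewrite /= !sum_row_mx scale_row_mx scale_scalar_mx scaler0 mulrN1 addrA.
rewrite !add_row_mx addr0 -!raddfD /= -[X in _ = X]row_mx0.
rewrite -(raddf0 (@scalar_mx R 1)).
case/eq_row_mx_scalar => comb /eqP; rewrite subr_eq0 => /eqP slack.
(* [slack]: the second-order sum equals the weight of the row [(0, -1)]. *)
right; exists (\row_i l i), mu; split=> [|j|j jA||].
- split=> [i|/rowP le0]; first by rewrite mxE.
  move: l1; rewrite big1 => [/eqP|i _]; first by rewrite eq_sym oner_eq0.
  by have := le0 i; rewrite !mxE.
- by rewrite mxE; case: ifP.
- by rewrite mxE (negPf jA).
- by rewrite -[RHS]comb; congr (_ + _); apply: eq_bigr => i _; rewrite mxE.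
- under eq_bigr do rewrite mxE.
  by rewrite slack.
Qed.

(** Weight the inequalities by the multipliers and add: the gradients cancel
    and what remains is [omega] times a nonnegative number, whereas a positive
    weight on one strict inequality makes the sum negative. *)
Lemma multipliers_exclude_solution (eta : 'rV[R]_s) (omega : R)
    (lambda : 'rV[R]_n) (mu : 'rV[R]_m) :
  0 <= omega ->
  (forall i, dot (F i) eta + omega * F2 i < 0) ->
  (forall j, j \in A -> dot (G j) eta + omega * G2 j <= 0) ->
  (forall i, 0 <= lambda ord0 i) -> lambda <> 0 ->
  (forall j, 0 <= mu ord0 j) ->
  \sum_(i < n) lambda ord0 i *: F i + \sum_(j in A) mu ord0 j *: G j = 0 ->
  0 <= \sum_(i < n) lambda ord0 i * F2 i + \sum_(j in A) mu ord0 j * G2 j ->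
  False.
Proof.
move=> o0 Flt Gle l0 /eqP/rV0Pn[i0 li0] u0 comb ge0.
have : 0 <= \sum_(i < n) lambda ord0 i * (dot (F i) eta + omega * F2 i) +
            \sum_(j in A) mu ord0 j * (dot (G j) eta + omega * G2 j).
  have /(congr1 (dot^~ eta)) := comb; rewrite dotDl !dot_suml dot0l => comb0.
  suff -> : \sum_(i < n) lambda ord0 i * (dot (F i) eta + omega * F2 i) +
            \sum_(j in A) mu ord0 j * (dot (G j) eta + omega * G2 j)
    = omega * (\sum_(i < n) lambda ord0 i * F2 i +
               \sum_(j in A) mu ord0 j * G2 j) by exact: mulr_ge0.
  rewrite -[RHS]add0r -[X in _ = X + _]comb0 mulrDr !mulr_sumr.
  rewrite addrACA -!big_split /=.
  by congr (_ + _); apply: eq_bigr => i _; rewrite dotZl; ring.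
apply/negP; rewrite -ltNge (bigD1 i0) //= -addrA ltr_wnDr //; last first.
  by rewrite pmulr_rlt0 ?Flt // lt_neqAle eq_sym li0 l0.
rewrite -oppr_ge0 opprD -!sumrN addr_ge0 //; apply: sumr_ge0 => i Hi.
  by rewrite -mulrN mulr_ge0 // oppr_ge0 ltW.
by rewrite -mulrN mulr_ge0 // oppr_ge0 Gle.
Qed.

End SecondOrderSystem.

(** * The characterization *)

Theorem proposition8 (R : realType) (s n m : nat) (X : set 'rV[R]_s)
    (f : 'rV[R]_s -> 'rV[R]_n) (g : 'rV[R]_s -> 'rV[R]_m)
    (openX : open X) (diffP : frechet_differentiable_problem X f g) :
  (forall x : 'rV[R]_s,
     KT_stationary2 X f g x -> global_pareto_minimizer X f g x) <->
  KT_pseudoinvexII2 X f g.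
Proof.
split=> [statmin|[d [eta [omega [omega0 invex]]]] x [xS stat]]; last first.
  split=> // -[y [yS ydom]].
  have [dcrit dder Flt Gle] := invex x y xS yS ydom.
  have [l [u [[l0 ln0] u0 _ comb ge0]]] := stat _ dcrit dder.
  apply: (multipliers_exclude_solution _ _ _ _ _ _ _ _ _
    (eta x y) (omega x y) l u _ _ _ l0 ln0 u0 comb ge0) => [|i|j jA].
  - by apply: omega0; [case: xS | case: yS].
  - by rewrite -diff_gradE.
  - by rewrite -diff_gradE Gle.
have sol (x y : 'rV[R]_s) :
    exists w : 'rV[R]_s * 'rV[R]_s * R, 0 <= w.2 /\
    (feasible X g x -> feasible X g y -> pareto_dominates f y x ->
     [/\ critical f g x w.1.1, derivable2_problem f g x w.1.1,
         forall i, 'd (coordf f i) x w.1.2 +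
                   w.2 * derive2 (coordf f i) x w.1.1 < 0 &
         forall j, j \in active g x ->
                   'd (coordf g j) x w.1.2 +
                   w.2 * derive2 (coordf g j) x w.1.1 <= 0]).
  have [[xS [yS ydom]]|nodom] :=
    pselect (feasible X g x /\ feasible X g y /\ pareto_dominates f y x);
    last by exists (0, 0, 0); split=> // xS yS ydom; case: nodom.
  apply: contrapT => nosol.
  have [|_ []] := statmin x; last by exists y.
  split=> // d dcrit dder.
  have [[eta [omega [w0 Flt Gle]]]|[l [u [l0 u0 uA comb ge0]]]] :=
    alternative_multipliers R s n m
      (fun i => grad (coordf f i) x) (fun i => derive2 (coordf f i) x d)
      (fun j => grad (coordf g j) x) (fun j => derive2 (coordf g j) x d)
      (active g x).
    case: nosol; exists (d, eta, omega); split=> // _ _ _; split=> // [i|j jA].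
      by rewrite diff_gradE.
    by rewrite diff_gradE Gle.
  exists l, u; split=> // j.
  have [|/uA -> ] := boolP (j \in active g x); last by rewrite mul0r.
  by rewrite inE => /eqP->; rewrite mulr0.
pose w x y := sval (cid (sol x y)).
have wP x y := svalP (cid (sol x y)).
exists (fun x y => (w x y).1.1), (fun x y => (w x y).1.2),
  (fun x y => (w x y).2).
by split=> x y; have [] := wP x y.
Qed.
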